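(* Let $A,B$ be finite subsets of the positive integers, let $(a_i)_{i\in A}$, $(b_i)_{i\in B}$ be real numbers, and let $i\in\{1,2,3\}$. Let $\mathcal{S}_i$, with weight function $w$ and length function $l$, be the step set of Class $i$ defined in the context. For integers $0\le m\le n$, let $\bar f_{i;n,m}$ be the sum of the weights $w(L)$ over all pointed $(\mathcal{S}_i,1)$-lattice paths $\dot L$ which (a) have length $l(L)=n+1$; (b) have non-positive pointed length $\overline{lp}(\dot L)=m$; (c) have final step of length at least $1$. Let $f_{i;n}$ be the sum of the weights of all $\mathcal{S}_i$-nonnegative paths of length $n$. Then for all integers $0\le m\le n$, $$\bar f_{i;n,m}=f_{i;n}.$$
   Context: Lattice paths. For a step set $\mathcal{S}\subset\mathbb{Z}\times\mathbb{Z}\setminus\{(0,0)\}$ and an integer $k$, an $(\mathcal{S},k)$-lattice path is a finite sequence $L=s_1s_2\cdots s_m$ ($m\ge 0$) of steps in $\mathcal{S}$, starting at $(0,0)=(x_0,y_0)$, with successive points $(x_j,y_j)=(x_{j-1},y_{j-1})+s_j$, and ending on the line $y=k$ (so $y_m=k$). Given a weight function $w:\mathcal{S}\to\mathbb{R}$ and a length function $l:\mathcal{S}\to\mathbb{R}$, put $w(L)=\prod_{j=1}^m w(s_j)$ and $l(L)=\sum_{j=1}^m l(s_j)$ (the empty path has weight $1$ and length $0$). An $\mathcal{S}$-nonnegative path is an $(\mathcal{S},0)$-lattice path that never goes below the line $y=0$ (the empty path is included). Non-positive length. The height of the step $s_j$ in $L$ is $h(s_j)=y_j$, the ordinate of its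 end point. The non-positive length is $\bar l(L)=\sum_{j:\,h(s_j)\le 0} l(s_j)$. Step sets ($A,B$ are finite sets of positive integers, $a_i,b_i$ real): Class 1: $\mathcal{S}_1=\{(2i-1,-1): i\in A\}\cup\{(2i,0): i\in B\}\cup\{(1,1)\}$, with $l((2i,0))=i$, $l((2i-1,-1))=i-1$, $l((1,1))=1$; $w((2i,0))=b_i$, $w((2i-1,-1))=a_i$, $w((1,1))=1$. Class 2: $\mathcal{S}_2=\{(i,-1): i\in A\}\cup\{(i,0): i\in B\}\cup\{(1,1)\}$, with $l((i,0))=i$, $l((i,-1))=i$, $l((1,1))=1$; $w((i,0))=b_i$, $w((i,-1))=a_i$, $w((1,1))=1$. Class 3: $\mathcal{S}_3=\{(1,-2i+1): i\in A\}\cup\{(2i,0): i\in B\}\cup\{(1,1)\}$, with $l((2i,0))=i$, $l((1,-2i+1))=0$, $l((1,1))=1$; $w((2i,0))=b_i$, $w((1,-2i+1))=a_i$, $w((1,1))=1$. Pointed paths. Let $L=s_1\cdots s_m$ be a nonempty $(\mathcal{S}_i,k)$-lattice path whose final step satisfies $l(s_m)\ge 1$. A pointed $(\mathcal{S}_i,k)$-lattice path with underlying path $L$ is $\dot L=[L,(x_m-2j,0)]$ for Classes 1 and 3, and $\dot L=[L,(x_m-j,0)]$ for Class 2, for some integer $0\le j\le l(s_m)-1$; that is, $L$ together with a marked point on the $x$-axis (equivalently, with the choice of $j$). Its pointed length is $p(\dot L)=j$, and its length and weight are those of $L$. The non-positive pointed length is $\overline{lp}(\dot L)=\bar l(L)+p(\dot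 L)$. *)

(* Defs.v *)
From mathcomp Require Import all_boot all_order all_algebra finmap.
From mathcomp Require Import all_classical reals.
From mathcomp Require Import zify ring lra.

Set Implicit Arguments.
Unset Strict Implicit.
Unset Printing Implicit Defensive.
Import Order.TTheory GRing.Theory Num.Theory.
Local Open Scope ring_scope.
Local Open Scope classical_set_scope.

Notation step := (int * int)%type.

Section LatticePaths.
Variables (R : realType) (S : {fset step}) (w l : step -> R).
Implicit Types (L : seq step) (k : int).

(* The point (x_j, y_j) reached after the first j steps. *)
Definition point_at L (j : nat) : step := \sum_(s <- take j L) s.

Definition lattice_path k L : Prop :=
  all (fun s => s \in S) L /\ (point_at L (size L)).2 = k.

Definition weight L : R := \prod_(s <- L) w s.

Definition path_length L : R := \sum_(s <- L) l s.

(* Steps are indexed from 0: step j ends at (x_{j+1}, y_{j+1}), so that its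
   height is y_{j+1}. *)
Definition height L (j : nat) : int := (point_at L j.+1).2.

Definition nonpos_length L : R :=
  \sum_(j < size L | height L j <= 0) l (nth (0, 0) L j).

Definition nonneg_path L : Prop :=
  lattice_path 0 L /\
  forall j, (j <= size L)%N -> 0 <= (point_at L j).2.

(* Only meaningful for nonempty paths. *)
Definition final_step L : step := last (0, 0) L.

(* A pointed path is encoded as a pair (L, j), where j is the integer that
   determines the marked point: (x_m - 2j, 0) in Classes 1 and 3, and
   (x_m - j, 0) in Class 2. *)
Definition pointed_path k (P : seq step * nat) : Prop :=
  [/\ lattice_path k P.1, P.1 != [::], 1 <= l (final_step P.1)
    & P.2%:R <= l (final_step P.1) - 1].

Definition pointed_length (P : seq step * nat) : nat := P.2.

Definition nonpos_pointed_length (P : seq step * nat) : R :=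
  nonpos_length P.1 + (pointed_length P)%:R.

Definition pointed_paths_of (n m : nat) : set (seq step * nat) :=
  [set P | [/\ pointed_path 1 P,
               path_length P.1 = n.+1%:R,
               nonpos_pointed_length P = m%:R
             & 1 <= l (final_step P.1)]].

Definition nonneg_paths_of (n : nat) : set (seq step) :=
  [set L | nonneg_path L /\ path_length L = n%:R].

(* The sum \sum_(_ \in X) _ is 0 by convention when infinitely many terms are
   nonzero; for the three classes below the index sets are finite, see
   [finite_pointed_paths_of] and [finite_nonneg_paths_of]. *)
Definition fbar (n m : nat) : R :=
  \sum_(P \in pointed_paths_of n m) weight P.1.

Definition fnonneg (n : nat) : R :=
  \sum_(L \in nonneg_paths_of n) weight L.

End LatticePaths.

Variant step_class := Class1 | Class2 | Class3.

Definition level_step (c : step_class) (i : nat) : step :=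
  match c with
  | Class1 => (2 * i%:Z, 0)
  | Class2 => (i%:Z, 0)
  | Class3 => (2 * i%:Z, 0)
  end.

Definition down_step (c : step_class) (i : nat) : step :=
  match c with
  | Class1 => (2 * i%:Z - 1, -1)
  | Class2 => (i%:Z, -1)
  | Class3 => (1, - (2 * i%:Z) + 1)
  end.

Definition up_step : step := (1, 1).

Definition step_set (c : step_class) (A B : {fset nat}) : {fset step} :=
  ([fset down_step c i | i in A] `|` [fset level_step c i | i in B]
   `|` [fset up_step])%fset.

(* The kind of a step of [step_set c A B] (up, level or down) is read off its
   ordinate, and its index i off its coordinates; [step_weightE] and
   [step_lengthE] give the resulting values on the three kinds of steps. *)
Definition step_weight (R : realType) (c : step_class) (a b : nat -> R)
    (s : step) : R :=
  if s.2 == 1 then 1 else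
  if s.2 == 0 then
    match c with
    | Class1 => b `|(s.1 %/ 2)%Z|%N
    | Class2 => b `|s.1|%N
    | Class3 => b `|(s.1 %/ 2)%Z|%N
    end
  else
    match c with
    | Class1 => a `|((s.1 + 1) %/ 2)%Z|%N
    | Class2 => a `|s.1|%N
    | Class3 => a `|((1 - s.2) %/ 2)%Z|%N
    end.

Definition step_length (R : realType) (c : step_class) (s : step) : R :=
  if s.2 == 1 then 1 else
  if s.2 == 0 then
    match c with
    | Class1 => s.1%:~R / 2
    | Class2 => s.1%:~R
    | Class3 => s.1%:~R / 2
    end
  else
    match c with
    | Class1 => (s.1%:~R - 1) / 2
    | Class2 => s.1%:~R
    | Class3 => 0
    end.

Lemma down_step_lt0 c i : (0 < i)%N -> (down_step c i).2 < 0.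
Proof. by case: c => /= i0; lia. Qed.

Lemma level_step_eq0 c i : (level_step c i).2 = 0.
Proof. by case: c. Qed.

Lemma step_weightE (R : realType) (c : step_class) (a b : nat -> R) :
  [/\ step_weight c a b up_step = 1,
      forall i, step_weight c a b (level_step c i) = b i
    & forall i, (0 < i)%N -> step_weight c a b (down_step c i) = a i].
Proof.
split=> [//|i|i i0].
  by rewrite /step_weight level_step_eq0 /=; case: c => /=; congr (b _); lia.
have d0 := down_step_lt0 c i0.
rewrite /step_weight ifF ?ifF; try lia.
by move: d0; case: c => /= _; congr (a _); lia.
Qed.

Lemma step_lengthE (R : realType) (c : step_class) :
  [/\ step_length R c up_step = 1,
      forall i, step_length R c (level_step c i) = i%:R
    & forall i, (0 < i)%N -> step_length R c (down_step c i) =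
        match c with Class1 => i%:R - 1 | Class2 => i%:R | Class3 => 0 end].
Proof.
split=> [//|i|i i0].
  rewrite /step_length level_step_eq0 /=; case: c => //=;
  by rewrite intrM -pmulrn; field.
have d0 := down_step_lt0 c i0.
rewrite /step_length ifF ?ifF; try lia.
by move: d0; case: c => //= _; rewrite intrB intrM -pmulrn; field.
Qed.

Section Finiteness.
Variables (R : realType) (c : step_class) (A B : {fset nat}).
Hypothesis A_gt0 : forall i, i \in A -> (0 < i)%N.
Hypothesis B_gt0 : forall i, i \in B -> (0 < i)%N.
Let S := step_set c A B.
Let l := step_length R c.

Lemma step_length_bounds s : s \in S -> 0 <= l s /\ 1 <= 2 * l s - s.2%:~R.
Proof.
have [Eu El Ed] := step_lengthE R c.
rewrite /S !inE => /orP[/orP[]|].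
- move=> /imfsetP[i /= /A_gt0 i0 ->]; rewrite /l Ed//.
  have : (1 : R) <= i%:R by rewrite ler1n.
  case: c => /= ?; rewrite ?intrD ?intrN ?intrM -?pmulrn; split; lra.
- move=> /imfsetP[i /= /B_gt0 i0 ->]; rewrite /l El level_step_eq0.
  have : (1 : R) <= i%:R by rewrite ler1n.
  by move=> ?; split; lra.
- by move=> /eqP ->; rewrite /l Eu /=; split; lra.
Qed.

Lemma size_lattice_path k L : lattice_path S k L ->
  (size L)%:R <= 2 * path_length l L - k%:~R.
Proof.
case=> + <-; rewrite /point_at take_size /path_length.
elim: L => [|s L IH] /=; first by rewrite !big_nil /= mulr0 subr0.
move=> /andP[/step_length_bounds[_ sb] /IH]; rewrite !big_cons /= intrD -natr1.
lra.
Qed.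

Lemma finite_bounded_seqs n :
  finite_set [set L : seq step | all (fun s => s \in S) L /\ (size L <= n)%N].
Proof.
elim: n => [|n IH].
  apply: (@sub_finite_set _ _ [set [::]]) => //= L [_].
  by rewrite leqn0 size_eq0 => /eqP.
apply: (@sub_finite_set _ _ ([set [::]] `|`
   [set s :: L | s in [set` S] &
     L in [set L | all (fun s => s \in S) L /\ (size L <= n)%N]])).
  move=> [|s L] /=; first by left.
  by move=> [/andP[sS LS] sL]; right; exists s => //; exists L.
rewrite finite_setU; split=> //.
by apply: finite_image2 => //; exact: finite_fset.
Qed.

Lemma finite_lattice_paths k n :
  finite_set [set L | lattice_path S k L /\ path_length l L = n%:R].
Proof.
apply: sub_finite_set (finite_bounded_seqs (2 * n + `|k|)) => L /= [Lk Ln].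
split; first by case: Lk.
have := size_lattice_path Lk; rewrite Ln => H.
have : ((size L)%:Z%:~R : R) <= (2 * n%:Z - k)%:~R.
  by rewrite intrB intrM -!pmulrn.
by rewrite ler_int; lia.
Qed.

Lemma finite_nonneg_paths_of n : finite_set (nonneg_paths_of S l n).
Proof.
by apply: sub_finite_set (finite_lattice_paths 0 n) => L [[]].
Qed.

Lemma nonpos_length_ge0 L : all (fun s => s \in S) L -> 0 <= nonpos_length l L.
Proof.
move=> /allP LS; apply: sumr_ge0 => j _.
by have [] := step_length_bounds (LS _ (mem_nth (0, 0) (ltn_ord j))).
Qed.

Lemma finite_pointed_paths_of n m : finite_set (pointed_paths_of S l n m).
Proof.
apply: (@sub_finite_set _ _
  ([set L | lattice_path S 1 L /\ path_length l L = n.+1%:R] `*` `I_m.+1)).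
  move=> [L j] /= [[/= LS _ _ _] Ln]; rewrite /nonpos_pointed_length /= => Lm _.
  split=> //=; rewrite ltnS -(@ler_nat R).
  have [/nonpos_length_ge0] := LS.
  by rewrite /pointed_length /= in Lm; lra.
by apply: finite_setX; [exact: finite_lattice_paths | exact: finite_II].
Qed.

End Finiteness.

(* Main.v *)
Require Import Defs.
From mathcomp Require Import all_boot all_order all_algebra finmap.
From mathcomp Require Import all_classical reals.
From mathcomp Require Import zify.

Set Implicit Arguments.
Unset Strict Implicit.
Unset Printing Implicit Defensive.
Import Order.TTheory GRing.Theory Num.Theory.
Local Open Scope ring_scope.

(** The statement is a cycle lemma of Chung-Feller type, and it holds for
    every step set whose lengths are natural numbers and whose only ascending
    step is (1, 1), of length 1 and weight 1.

    Read a word L of N steps that climbs by 1 in total as a cyclic word. Its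
    rotations are the candidates for a path from height 0 to height 1, and
    rotating keeps weight and length. Consider the rotation whose final step
    is the t-th step of L. The step p ends at a height that is at most 0 in
    this rotation exactly when its tilted height N * y_p - p is smaller than
    that of t: the tilt subtracts the mean slope 1/N, so tilted heights do not
    depend on where the cyclic word is cut, and they are pairwise distinct
    because it breaks ties between equal heights in favour of the later step.
    Hence the non-positive length of the rotation is the total length of
    the steps that come before t in the order of tilted heights, and, as the
    marked point of a pointed path ranges over its positions, the
    non-positive pointed length ranges over an interval as long as step t that
    begins at this number. Placed end to end in that order, the steps tile
    [0, n + 1), so each m <= n is attained by exactly one rotation of L and
    one marked point ([hits_rot_ex], [hits_rot_uniq]). Sending a path that
    attains m to its rotation that attains m' is thus a weight-preserving
    bijection ([hitting_shift]), and the sum does not depend on m.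

    For m = n the sum is read off directly. There every step of positive
    length but the last ends at height at most 0; a path cannot reach a
    positive height before its last step, since it would do so by an up step,
    of length 1. So it is a path from height 0 to 0 that never goes above the
    axis, followed by an up step, and reversing the order of the steps makes
    this first part nonnegative ([hitting_last]). *)

(** * Stacking intervals in the order of a key *)

Lemma leq_subsum (I : finType) (len : I -> nat) (P Q : pred I) : subpred P Q ->
  (\sum_(p | P p) len p <= \sum_(p | Q p) len p)%N.
Proof. by move=> PQ; apply: sub_le_big => //= x y; apply: leq_addr. Qed.

Section Stacking.
Variables (I : finType) (key : I -> int) (len : I -> nat).
Hypothesis key_inj : injective key.

(** The left end of the interval of [t] when intervals of lengths [len] are
    laid end to end from 0 in increasing order of [key]. *)
Definition offset t := (\sum_(p | (key p < key t)%R) len p)%N.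

Lemma offset_endE t :
  (offset t + len t = \sum_(p | (key p <= key t)%R) len p)%N.
Proof.
rewrite [RHS](bigD1 t)//= addnC; congr addn; apply: eq_bigl => p.
by rewrite lt_neqAle (inj_eq key_inj) andbC.
Qed.

Lemma leq_offset t u : key t < key u -> (offset t + len t <= offset u)%N.
Proof.
by move=> tu; rewrite offset_endE leq_subsum// => p /le_lt_trans; apply.
Qed.

Lemma offset_uniq m t u :
  (offset t <= m < offset t + len t)%N ->
  (offset u <= m < offset u + len u)%N -> t = u.
Proof.
move=> mt mu; apply: key_inj.
by case: (ltgtP (key t) (key u)) => // /leq_offset; lia.
Qed.

(** Only the member of [P] with the largest key matters: all of [P] is stacked
    below the right end of its interval. *)
Lemma leq_sum_offset_end (P : pred I) m :
  (forall t, P t -> offset t + len t <= m)%N -> (\sum_(p | P p) len p <= m)%N.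
Proof.
move=> Pm; have [p0 Pp0|P0] := pickP P; last by rewrite big_pred0.
have [t Pt t_max] := Order.TotalTheory.arg_maxP key Pp0.
by apply: leq_trans (Pm t Pt); rewrite offset_endE leq_subsum.
Qed.

(** The interval containing [m] is the lowest one that ends beyond [m]: all
    those below it end at [m] or before, hence so does their total length. *)
Lemma offset_ex m : (m < \sum_p len p)%N ->
  exists t, (offset t <= m < offset t + len t)%N.
Proof.
move=> m_lt; pose past t := (m < offset t + len t)%N.
have [t0 past_t0|none] := pickP past; last first.
  suff : (\sum_p len p <= m)%N by rewrite leqNgt m_lt.
  by apply: leq_sum_offset_end => t _; rewrite leqNgt -/(past t) none.
have [t past_t t_min] := Order.TotalTheory.arg_minP key past_t0.
exists t; rewrite [X in _ && X]past_t andbT.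
apply: leq_sum_offset_end => p pt; rewrite leqNgt.
by apply: contraL pt => /t_min; rewrite -leNgt.
Qed.
End Stacking.

(** * Rotations of a word that climbs by one *)

Section Rotations.
Variable len : step -> nat.
Implicit Types (L M : seq step) (m : nat).

Definition rise L : int := \sum_(s <- L) s.2.

(** [nonpos_length] as a natural number, for a natural-valued length. *)
Definition nplen L : nat :=
  (\sum_(j < size L | (rise (take j.+1 L) <= 0)%R) len (nth (0, 0)%R L j))%N.

(** Some choice of the marked point on [L] gives the non-positive pointed
    length [m]; its pointed length is then [m - nplen L]. *)
Definition hits m L : bool :=
  (nplen L <= m < nplen L + len (last (0, 0)%R L))%N.

(** The height at which step [p] ends, lowered by the mean slope of a word that
    climbs by 1; scaling by [size L] keeps it an integer. For such a word it is
    periodic along the infinite repetition of the word. *)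
Definition tilt L (p : nat) : int :=
  (size L)%:Z * rise (take p.+1 L) - p%:Z.

Lemma rise_cat L M : rise (L ++ M) = rise L + rise M.
Proof. by rewrite /rise big_cat. Qed.

Lemma rise_rcons L s : rise (rcons L s) = rise L + s.2.
Proof. by rewrite -cats1 rise_cat [X in _ + X]/rise big_seq1. Qed.

Lemma rise_perm L M : perm_eq L M -> rise L = rise M.
Proof. exact: perm_big. Qed.

(** Equal values at [p] and [q] would make [p - q] a multiple of [size L]. *)
Lemma tilt_inj L : injective (fun p : 'I_(size L) => tilt L p).
Proof.
move=> p q; rewrite /tilt; set y := rise _; set z := rise _ => pq.
have {pq} : (size L)%:Z * (y - z) = p%:Z - q%:Z by lia.
have := ltn_ord p; have := ltn_ord q => qL pL yz; apply: val_inj => /=.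
by case: (ltgtP (y - z) 0) => yz0; nia.
Qed.

(** In a rotation, the step that comes [d] places after the cut compares its
    tilted height with that of the step just before the cut; the displacement
    [d] is too small to alter the sign. *)
Lemma le0_tilt (N d : nat) (x : int) : (0 < d <= N)%N ->
  (x <= 0) = (N%:Z * x < d%:Z).
Proof. by case: (lerP x 0) => x0 dN; apply/esym/idP; nia. Qed.

Lemma big_size_cat L M (F : nat -> nat) :
  (\sum_(j < size (L ++ M)) F j =
   \sum_(j < size L) F j + \sum_(j < size M) F (size L + j))%N.
Proof.
rewrite -!(big_mkord xpredT) size_cat.
rewrite (@big_cat_nat _ _ _ (size L)) ?leq_addr//= !big_mkord; congr addn.
rewrite -[X in \sum_(X <= _ < _) _]add0n big_addn addKn big_mkord.
by apply: eq_bigr => j _; rewrite addnC.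
Qed.

(** [V ++ U] is the rotation of [U ++ V] that ends with step [t]. In it a step
    of [U] is found one turn later, which raises it by the total climb 1 but
    moves it [size (U ++ V)] places on, so its tilted height is unchanged. *)
Lemma nplen_swap (U V : seq step) t : size U = t.+1 -> rise (U ++ V) = 1 ->
  nplen (V ++ U) =
  (\sum_(p < size (U ++ V) | (tilt (U ++ V) p < tilt (U ++ V) t)%R)
     len (nth (0, 0)%R (U ++ V) p))%N.
Proof.
move=> UE; rewrite rise_cat /nplen /tilt -[in take t.+1 _]UE => UV1.
rewrite [take (size U) _]take_size_cat//.
rewrite big_mkcond [in RHS]big_mkcond /=.
rewrite (big_size_cat _ _ (fun j => if (rise (take j.+1 (V ++ U)) <= 0)%R
  then len (nth (0, 0)%R (V ++ U) j) else 0%N)).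
rewrite (big_size_cat _ _ (fun p => if (size (U ++ V))%:Z *
  rise (take p.+1 (U ++ V)) - p%:Z < (size (U ++ V))%:Z * rise U - t%:Z
  then len (nth (0, 0)%R (U ++ V) p) else 0%N)) addnC size_cat.
congr addn; apply: eq_bigr => -[j jlt] _ /=.
  (* Step j of U comes size U + size V + j - t places after step t of
     the previous turn; for j = t this is a full turn, and both sides fail. *)
  rewrite -addnS (takeD (size V)) take_size_cat// drop_size_cat// rise_cat.
  rewrite takel_cat// !nth_cat jlt ltnNge leq_addr /= addKn.
  rewrite (@le0_tilt (size U + size V) (size U + size V + j - t)); last lia.
  have -> : rise U = 1 - rise V by rewrite -UV1 addrK.
  by congr (if _ then _ else _); set N := (size U + size V)%N; lia.
rewrite -addnS (takeD (size U)) [take (size U) _]take_size_cat//.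
rewrite drop_size_cat// rise_cat takel_cat// !nth_cat jlt.
rewrite ltnNge leq_addr /= addKn.
rewrite (@le0_tilt (size U + size V) j.+1); last lia.
by congr (if _ then _ else _); set N := (size U + size V)%N; lia.
Qed.

Lemma nplen_rot L (t : 'I_(size L)) : rise L = 1 ->
  nplen (rot t.+1 L) =
  offset (fun p : 'I_(size L) => tilt L p) (fun p => len (nth (0, 0)%R L p)) t.
Proof.
move=> L1; have := @nplen_swap (take t.+1 L) (drop t.+1 L) t.
by rewrite cat_take_drop => -> //; rewrite size_takel.
Qed.

Lemma last_rot L (t : 'I_(size L)) : last (0, 0) (rot t.+1 L) = nth (0, 0) L t.
Proof.
by rewrite /rot (take_nth (0, 0)) ?ltn_ord// -rcons_cat last_rcons.
Qed.

Lemma sum_len L :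
  (\sum_(p < size L) len (nth (0, 0)%R L p) = \sum_(s <- L) len s)%N.
Proof. by rewrite (big_nth (0, 0)%R) big_mkord. Qed.

Lemma hits_rot_ex m L : rise L = 1 -> (m < \sum_(s <- L) len s)%N ->
  exists2 t, (t < size L)%N & hits m (rot t.+1 L).
Proof.
move=> L1; rewrite -sum_len => /(offset_ex (@tilt_inj L))[t].
by rewrite -nplen_rot// -last_rot => mt; exists t.
Qed.

Lemma hits_rot_uniq m L t u : rise L = 1 ->
  (t < size L)%N -> (u < size L)%N ->
  hits m (rot t.+1 L) -> hits m (rot u.+1 L) -> t = u.
Proof.
move=> L1 tL uL; rewrite /hits.
rewrite (nplen_rot (Ordinal tL))// (last_rot (Ordinal tL)).
rewrite (nplen_rot (Ordinal uL))// (last_rot (Ordinal uL)).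
by move=> mt /(offset_uniq (@tilt_inj L) mt)[].
Qed.

(** The rotation of [L] that hits [m]. *)
Definition turn m L : seq step :=
  rot (find (fun t => hits m (rot t.+1 L)) (iota 0 (size L))).+1 L.

Lemma turnP m L : rise L = 1 -> (m < \sum_(s <- L) len s)%N ->
  exists2 t, (t < size L)%N & turn m L = rot t.+1 L /\ hits m (turn m L).
Proof.
move=> L1 mL; rewrite /turn; set P := (fun t => hits m _).
have Pex : has P (iota 0 (size L)).
  have [t tL mt] := hits_rot_ex L1 mL.
  by apply/hasP; exists t; rewrite ?mem_iota.
have := nth_find 0%N Pex; have := Pex; rewrite has_find size_iota => fL.
by rewrite nth_iota// add0n; exists (find P (iota 0 (size L))).
Qed.

Lemma perm_turn m L : perm_eq (turn m L) L.
Proof. by rewrite /turn perm_rot. Qed.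

Lemma rot_back (L : seq step) t : (t < size L)%N ->
  exists2 v, (v < size (rot t.+1 L))%N & rot v.+1 (rot t.+1 L) = L.
Proof.
rewrite size_rot leq_eqVlt => /orP[/eqP tL|tL].
  exists t; first by rewrite -tL.
  by rewrite tL !rot_size.
exists (size L - t.+1).-1; first lia.
rewrite prednK ?subn_gt0//; have := rotK t.+1 L.
by rewrite /rotr size_rot.
Qed.

(** [L] is its own rotation by [size L], so [m] lies in one of the stacked
    intervals. *)
Lemma hits_lt m L : rise L = 1 -> hits m L -> (m < \sum_(s <- L) len s)%N.
Proof.
case: L => [|s L].
  by rewrite /rise !big_nil => /eqP.
move=> L1 /andP[_ m_lt]; apply: leq_trans m_lt _; rewrite -sum_len.
have := rot_size (s :: L); set t : 'I_(size (s :: L)) := ord_max => tE.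
rewrite -[X in nplen X]tE -[X in last _ X]tE.
rewrite (nplen_rot t)// (last_rot t) offset_endE; last exact: tilt_inj.
exact: leq_subsum.
Qed.

(** Both sides are rotations of [turn m' L] that hit [m], and there is only
    one. *)
Lemma turnK m m' L : rise L = 1 -> (m' < \sum_(s <- L) len s)%N ->
  hits m L -> turn m (turn m' L) = L.
Proof.
move=> L1 mL' hL; have [t tL [tE _]] := turnP L1 mL'.
have [v vM vE] := rot_back tL; rewrite -tE in vM vE.
have M1 : rise (turn m' L) = 1 by rewrite (rise_perm (perm_turn _ _)).
have mM : (m < \sum_(s <- turn m' L) len s)%N.
  by rewrite (perm_big _ (perm_turn _ _)) hits_lt.
have [u uM [uE hu]] := turnP M1 mM; rewrite uE -[RHS]vE.
by rewrite (@hits_rot_uniq m _ u v M1)// -?uE// vE.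
Qed.

Lemma rise_take_rev L j : (j <= size L)%N ->
  rise (take j (rev L)) = rise L - rise (take (size L - j) L).
Proof.
move=> jL; rewrite take_rev.
rewrite (rise_perm (M := drop (size L - j) L)) ?perm_rev//.
by rewrite -[X in rise X - _](cat_take_drop (size L - j)) rise_cat addrC addKr.
Qed.

Lemma nplen_rcons L s :
  nplen (rcons L s) =
  (nplen L + if (rise (rcons L s) <= 0)%R then len s else 0)%N.
Proof.
rewrite /nplen big_mkcond [in RHS]big_mkcond -cats1 /=.
rewrite (big_size_cat _ _ (fun j => if (rise (take j.+1 (L ++ [:: s])) <= 0)%R
  then len (nth (0, 0)%R (L ++ [:: s]) j) else 0%N)) big_ord1.
congr addn; last first.
  by rewrite addn0 nth_cat ltnn subnn take_oversize// size_cat addn1.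
by apply: eq_bigr => -[j jL] _ /=; rewrite takel_cat// nth_cat jL.
Qed.

Lemma nplen_full L : (forall j, (j <= size L)%N -> rise (take j L) <= 0) ->
  nplen L = (\sum_(s <- L) len s)%N.
Proof.
move=> L0; rewrite -sum_len; apply: eq_bigl => j.
by rewrite L0// ltn_ord.
Qed.

Lemma nplen_above L j : (j < size L)%N -> 0 < rise (take j.+1 L) ->
  (nplen L + len (nth (0, 0)%R L j) <= \sum_(s <- L) len s)%N.
Proof.
move=> jL j0; rewrite -sum_len (bigD1 (Ordinal jL))//= addnC leq_add2l.
by apply: leq_subsum => i; apply: contraTneq => ->; rewrite -ltNge.
Qed.
End Rotations.

(** * Sums over paths *)

Section PathSums.
Variables (R : realType) (S : {fset step}) (w l : step -> R).
Variable len : step -> nat.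
Hypothesis lE : forall s : step, s \in S -> l s = (len s)%:R.
Implicit Types (L : seq step) (m n : nat).

Lemma point_at_rise L j : (point_at L j).2 = rise (take j L).
Proof.
rewrite /point_at /rise; elim: (take j L) => [|s M IH].
  by rewrite !big_nil.
by rewrite !big_cons -IH.
Qed.

Lemma lattice_pathP k L :
  lattice_path S k L <-> all (fun s => s \in S) L /\ rise L = k.
Proof. by rewrite /lattice_path point_at_rise take_size. Qed.

Lemma path_lengthE L : all (fun s => s \in S) L ->
  path_length l L = (\sum_(s <- L) len s)%:R.
Proof.
move=> /allP LS; rewrite natr_sum /path_length; rewrite !big_seq.
by apply: eq_bigr => s /LS /lE.
Qed.

Lemma nonpos_lengthE L : all (fun s => s \in S) L ->
  nonpos_length l L = (nplen len L)%:R.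
Proof.
move=> /allP LS; rewrite natr_sum /nonpos_length.
apply: eq_big => [j|j _]; first by rewrite /height point_at_rise.
by rewrite lE// LS// mem_nth.
Qed.

Definition hitting n m : set (seq step) := [set L |
  [/\ all (fun s => s \in S) L, rise L = 1,
      (\sum_(s <- L) len s)%N = n.+1 & hits len m L]].

Lemma last_in L : all (fun s => s \in S) L -> L != [::] -> last (0, 0) L \in S.
Proof. by case: L => // s L /allP LS _; apply: LS; rewrite /= mem_last. Qed.

(** The marked point is determined by the path and [m], so that pointed paths
    can be replaced by paths. *)
Lemma fbar_hitting n m :
  fbar S w l n m = \sum_(L \in hitting n m) weight w L.
Proof.
apply: (@reindex_fsbig _ _ _ _ _ (fun L => (L, m - nplen len L)%N)).
split.
- move=> L [LS L1 Ln /andP[mge mlt]].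
  have L0 : L != [::] by apply: contra_eqN Ln => /eqP ->; rewrite big_nil.
  have lastS := last_in LS L0.
  have last_ge1 : 1 <= l (last (0, 0) L) by rewrite lE// ler1n; lia.
  split=> //=.
  + split=> //; first exact/lattice_pathP.
    by rewrite lerBrDr natr1 /final_step/= lE// ler_nat ltn_subLR.
  + by rewrite path_lengthE// Ln.
  + by rewrite /nonpos_pointed_length nonpos_lengthE//= -natrD subnKC.
- by move=> L M _ _ [].
- move=> [L j] [[/lattice_pathP[/= LS L1] L0 _]].
  rewrite path_lengthE// /nonpos_pointed_length nonpos_lengthE//=.
  rewrite lerBrDr natr1 /final_step lE ?last_in// -natrD ler_nat => jl.
  move=> /eqP + /eqP + _; rewrite !eqr_nat => /eqP Ln /eqP mE.
  exists L; last by rewrite -mE addKn.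
  by split=> //; rewrite /hits -mE leq_addr ltn_add2l.
Qed.

(** Independence of [m]: rotating to [m'] and rotating back to [m] are inverse
    to each other. *)
Lemma hitting_shift n m m' : (m <= n)%N -> (m' <= n)%N ->
  \sum_(L \in hitting n m) weight w L = \sum_(L \in hitting n m') weight w L.
Proof.
have turn_in k k' L : (k' <= n)%N -> hitting n k L ->
    hitting n k' (turn len k' L).
  move=> kn [LS L1 Ln kL]; have p := perm_turn len k' L.
  split; rewrite ?(perm_all _ p) ?(rise_perm p) ?(perm_big _ p)//=.
  by have [||t _ []] := @turnP len k' L; rewrite ?Ln.
have turn_can k k' L : (k' <= n)%N -> hitting n k L ->
    turn len k (turn len k' L) = L.
  by move=> kn [_ L1 Ln kL]; apply: turnK; rewrite ?Ln.
move=> mn mn'; rewrite (@reindex_fsbig _ _ _ _ _ (turn len m) (hitting n m')).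
  apply: eq_fsbigr => L _; apply: perm_big; exact: perm_turn.
split.
- by move=> L /turn_in; apply.
- move=> L M /set_mem hL /set_mem hM LM.
  by rewrite -(turn_can m' m L)// -(turn_can m' m M)// LM.
- by move=> L hL; exists (turn len m' L); [exact: turn_in hL|exact: turn_can].
Qed.

(* From here on the up step is the only way to gain height. *)
Hypothesis up_in : up_step \in S.
Hypothesis upP : forall s : step, s \in S -> 0 < s.2 -> s = up_step.
Hypothesis len_up : len up_step = 1%N.
Hypothesis w_up : w up_step = 1.

(** Reversing the order of the steps of a closed path reflects its sequence of
    heights in the axis, turning a nonnegative path into a nonpositive one. *)
Definition close L : seq step := rcons (rev L) up_step.

Lemma close_hitting n L : nonneg_paths_of S l n L -> hitting n n (close L).
Proof.
move=> [[/lattice_pathP[LS L0] Lge0]].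
rewrite path_lengthE// => /eqP; rewrite eqr_nat => /eqP Ln.
have revn : (\sum_(s <- rev L) len s)%N = n by rewrite (perm_big L) ?perm_rev.
have close1 : rise (close L) = 1.
  by rewrite /close rise_rcons (rise_perm (M := L)) ?perm_rev// L0.
split=> //.
- by rewrite /close all_rcons up_in all_rev.
- by rewrite /close big_rcons /= revn len_up addn1.
- rewrite /hits {2}/close last_rcons len_up addn1 ltnS -eqn_leq.
  rewrite /close nplen_rcons -/(close L) close1 lt_geF// addn0.
  rewrite nplen_full ?revn// => j; rewrite size_rev => jL.
  rewrite rise_take_rev// L0 sub0r oppr_le0.
  by rewrite -point_at_rise Lge0// leq_subr.
Qed.

(** At the extreme value [n], no positive length may be spent above the axis
    before the last step. *)
Lemma hitting_close n M : hitting n n M ->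
  exists2 L, nonneg_paths_of S l n L & close L = M.
Proof.
case/lastP: M => [|M s] [].
  by rewrite /rise big_nil => _ /eqP.
rewrite all_rcons big_rcons /hits last_rcons nplen_rcons /=.
move=> /andP[sS MS] M1 Mn; rewrite M1 lt_geF// addn0 => /andP[_ nlt].
have Mle0 j : (j <= size M)%N -> rise (take j M) <= 0.
  elim: j => [|j IH] jM; first by rewrite take0 /rise big_nil.
  (* The first step to end above the axis is an up step, and its
     length 1 would be missing from the non-positive length. *)
  rewrite leNgt; apply/negP => j_gt0; have := nplen_above len jM j_gt0.
  have nS : nth (0, 0) M j \in S by exact/(allP MS)/mem_nth.
  rewrite (upP nS) ?len_up; first lia.
  move: j_gt0; rewrite (take_nth (0, 0))// rise_rcons => /lt_le_trans; apply.
  by rewrite gerDr IH// ltnW.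
have := Mle0 _ (leqnn _); rewrite take_size => rM.
move: M1; rewrite rise_rcons => M1.
have sE : s = up_step by apply: upP => //; lia.
have rM0 : rise M = 0 by move: M1; rewrite sE /=; lia.
exists (rev M); last by rewrite /close revK sE.
split.
  split.
    apply/lattice_pathP.
    by rewrite all_rev (rise_perm (M := M)) ?perm_rev.
  move=> j; rewrite size_rev => jM; rewrite point_at_rise rise_take_rev//.
  by rewrite rM0 sub0r oppr_ge0 Mle0// leq_subr.
rewrite path_lengthE ?all_rev// (perm_big M) ?perm_rev//.
by move: Mn; rewrite sE len_up addn1 => -[->].
Qed.

Lemma hitting_last n :
  \sum_(L \in hitting n n) weight w L = fnonneg S w l n.
Proof.
rewrite (@reindex_fsbig _ _ _ _ _ close (nonneg_paths_of S l n)).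
  apply: eq_fsbigr => L _; rewrite /weight big_rcons /= w_up mulr1.
  by apply: perm_big; rewrite perm_rev.
split.
- by move=> L /close_hitting.
- by move=> L M _ _ /rcons_inj[] /(can_inj revK).
- by move=> M /hitting_close.
Qed.

Lemma fbar_fnonneg n m : (m <= n)%N -> fbar S w l n m = fnonneg S w l n.
Proof.
by move=> mn; rewrite fbar_hitting (hitting_shift mn (leqnn n)) hitting_last.
Qed.
End PathSums.

(** * The three classes *)

(** [step_length] with natural values; the two agree on [step_set c A B]. *)
Definition nat_length (c : step_class) (s : step) : nat :=
  if s.2 == 1 then 1%N else
  if s.2 == 0 then
    match c with Class2 => `|s.1|%N | _ => `|(s.1 %/ 2)%Z|%N end
  else
    match c with
    | Class1 => `|((s.1 - 1) %/ 2)%Z|%N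
    | Class2 => `|s.1|%N
    | Class3 => 0%N
    end.

Theorem theorem3p4 (R : realType) (A B : {fset nat})
    (hA : forall i, i \in A -> (0 < i)%N)
    (hB : forall i, i \in B -> (0 < i)%N)
    (a b : nat -> R) (c : step_class) (n m : nat) (hmn : (m <= n)%N) :
  fbar (step_set c A B) (step_weight c a b) (step_length R c) n m =
  fnonneg (step_set c A B) (step_weight c a b) (step_length R c) n.
Proof.
have upS : up_step \in step_set c A B by rewrite !inE eqxx orbT.
have upP s : s \in step_set c A B -> 0 < s.2 -> s = up_step.
  rewrite !inE => /orP[/orP[]|/eqP//] /imfsetP[i /= iAB ->].
    by rewrite ltNge ltW// down_step_lt0// hA.
  by rewrite level_step_eq0.
have [_ ll ld] := step_lengthE R c.
have lE s : s \in step_set c A B -> step_length R c s = (nat_length c s)%:R.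
  rewrite !inE => /orP[/orP[]|/eqP->//] /imfsetP[i /= iAB ->].
    have i0 := hA _ iAB; have d0 := down_step_lt0 c i0.
    rewrite ld// /nat_length ifF ?ifF; try lia.
    case: c {d0 ld ll upP upS} => //=.
      by rewrite -(@natrB _ i 1)//; congr _%:R; lia.
  by rewrite ll /nat_length level_step_eq0 /=; case: c {ld ll upP upS} => /=;
    congr _%:R; lia.
have [wu _ _] := step_weightE c a b.
by apply: (fbar_fnonneg lE); rewrite // /nat_length.
Qed.
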